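(* Let $\mathfrak G$ be a family of finite simple groups. Then every quasiregular coherent configuration $\mathcal X$ of type $\mathfrak G$ is the direct sum of semiregular coherent configurations. In particular, $\mathcal X$ is schurian and separable.
   Context: A coherent configuration is a pair $(\Omega,S)$ where $\Omega$ is a finite set and $S$ is a partition of $\Omega\times\Omega$ (basis relations) such that $1_\Omega$ is a union of basis relations, $s^*=\{(\beta,\alpha):(\alpha,\beta)\in s\}\in S$ for all $s\in S$, and for all $r,s,t\in S$ the number $c^t_{rs}=|\alpha r\cap\beta s^*|$ is independent of $(\alpha,\beta)\in t$, where $\alpha r=\{\beta:(\alpha,\beta)\in r\}$. A fiber is a set $\Delta$ with $1_\Delta\in S$. A relation $s$ is thin if $|\alpha s|\le1$ and $|\alpha s^*|\le1$ for all $\alpha$. The configuration is semiregular if all its basis relations are thin, and quasiregular if for each fiber all basis relations contained in its square are thin; it is of type $\mathfrak G$ if the group (under composition of relations) of basis relations contained in $\Delta\times\Delta$ belongs to $\mathfrak G$ for each fiber $\Delta$. $\mathcal X$ is the direct sum of coherent configurations $(\Omega_J,S_J)$, $J$ in some index set, if $\Omega$ is the disjoint union of the $\Omega_J$ and $S$ consists of the elements of the $S_J$ together with all $\Omega_J\times\Omega_K$ for $J\ne K$. Schurian: $S$ is the set of orbits on $\Omega\times\Omega$ of some permutation group on $\Omega$. Separable: for every coherent configuration $(\Omega',S')$ and bijection $\varphi:S\to S'$ with $c^t_{rs}=c^{\varphi(t)}_{\varphi(r)\varphi(s)}$ for all $r,s,t$, there is a bijection $f:\Omega\to\Omega'$ with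 $\{(\alpha^f,\beta^f):(\alpha,\beta)\in s\}=\varphi(s)$ for all $s\in S$.
   Formalization: In the direct sum, the basis relations between distinct summands are taken to be all products Δ×Γ of a fiber of one and a fiber of the other, instead of Ω_J×Ω_K, since the claim is false with the latter when a summand has several fibers. *)

(* Defs.v *)
From mathcomp Require Import all_boot all_fingroup all_solvable.

Set Implicit Arguments.
Unset Strict Implicit.
Unset Printing Implicit Defensive.

Import GroupScope.

Section CoherentConfigurations.

Variable T : finType.

Implicit Types (D : {set T}) (r s t : {set T * T}) (S : {set {set T * T}}).

Definition diag_rel D : {set T * T} := [set p | (p.1 == p.2) && (p.1 \in D)].

Definition conv_rel s : {set T * T} := [set p | (p.2, p.1) \in s].

Definition comp_rel r s : {set T * T} :=
  [set p | [exists b, ((p.1, b) \in r) && ((b, p.2) \in s)]].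

Definition neighbors (a : T) r : {set T} := [set b | (a, b) \in r].

Definition inter_num_at r s (p : T * T) : nat :=
  #|neighbors p.1 r :&: neighbors p.2 (conv_rel s)|.

(* c^t_{rs}; the choice of p is irrelevant when t is a basis relation of a
   coherent configuration, and such a t is never empty. *)
Definition inter_num r s t : nat :=
  if [pick p in t] is Some p then inter_num_at r s p else 0.

(* (D, S) is a coherent configuration.  The point set is a subset D of an
   ambient finite type, so that the summands of a direct sum need no change of
   type; [set: T] is the point set consisting of all of T. *)
Definition coherent D S : Prop :=
  [/\ partition S (setX D D),
      exists2 S0 : {set {set T * T}}, S0 \subset S & cover S0 = diag_rel D,
      forall s, s \in S -> conv_rel s \in S
    & forall r s t, r \in S -> s \in S -> t \in S ->
        forall p q, p \in t -> q \in t ->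
          inter_num_at r s p = inter_num_at r s q].

Definition fibers S : {set {set T}} := [set D | diag_rel D \in S].

Definition basis_within D S : {set {set T * T}} :=
  [set s in S | s \subset setX D D].

Definition thin s : Prop :=
  forall a, #|neighbors a s| <= 1 /\ #|neighbors a (conv_rel s)| <= 1.

Definition semiregular_cc S : Prop := forall s, s \in S -> thin s.

Definition quasiregular_cc S : Prop :=
  forall D s, D \in fibers S -> s \in basis_within D S -> thin s.

(* Between distinct summands the basis relations are the products of a fiber
   of one by a fiber of the other (reflexive relations of a coherent
   configuration separate its fibers, so Omega_J x Omega_K itself is a basis
   relation only when both summands have a single fiber). *)
Definition direct_sum (I : finType) (Omega : I -> {set T})
    (SS : I -> {set {set T * T}}) S : Prop :=
  [/\ forall i j, i != j -> [disjoint Omega i & Omega j],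
      \bigcup_i Omega i = [set: T]
    & forall s, s \in S <->
        (exists i, s \in SS i) \/
        (exists i j D E, [/\ i != j, D \in fibers (SS i), E \in fibers (SS j)
                           & s = setX D E])].

Definition pair_orbit (G : {set {perm T}}) (p : T * T) : {set T * T} :=
  [set (g p.1, g p.2) | g : {perm T} in G].

Definition schurian S : Prop :=
  exists G : {group {perm T}}, S = [set pair_orbit G p | p : T * T].

End CoherentConfigurations.

Definition rel_image (T T' : finType) (f : T -> T') (s : {set T * T}) :
  {set T' * T'} := [set (f p.1, f p.2) | p in s].

Definition algebraic_iso (T T' : finType) (S : {set {set T * T}})
    (S' : {set {set T' * T'}}) (phi : {set T * T} -> {set T' * T'}) : Prop :=
  [/\ {in S &, injective phi}, phi @: S = S'
    & forall r s t, r \in S -> s \in S -> t \in S ->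
        inter_num r s t = inter_num (phi r) (phi s) (phi t)].

Definition separable_cc (T : finType) (S : {set {set T * T}}) : Prop :=
  forall (T' : finType) (S' : {set {set T' * T'}})
         (phi : {set T * T} -> {set T' * T'}),
    coherent [set: T'] S' -> algebraic_iso S S' phi ->
    exists2 f : T -> T', bijective f
      & forall s, s \in S -> rel_image f s = phi s.

Definition group_family : Type := forall gT : finGroupType, {group gT} -> Prop.

(* The set basis_within D S, with composition of relations as the product, is
   isomorphic to a member of GG. *)
Definition of_type (GG : group_family) (T : finType) (S : {set {set T * T}}) :
  Prop :=
  forall D, D \in fibers S ->
    exists (gT : finGroupType) (G : {group gT}) (phi : gT -> {set T * T}),
      [/\ GG gT G, {in G &, injective phi}, phi @: G = basis_within D S
        & {in G &, forall x y, phi (x * y) = comp_rel (phi x) (phi y)}].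

(* Main.v *)
Require Import Defs.
From mathcomp Require Import all_boot all_fingroup all_solvable.

Set Implicit Arguments.
Unset Strict Implicit.
Unset Printing Implicit Defensive.

Import GroupScope.

(* Call the basis relation of (x, y) its colour.  For fibers D and E, the group
   of colours on D acts regularly on D, and the elements that identify points
   with the same colours towards E form a normal subgroup.  By simplicity it is
   trivial or everything, so the basis relations from D to E are either all thin
   or reduce to D x E; nontriviality of the groups rules out the mixed case
   (trivial on one side, everything on the other).  Having a thin colour is an equivalence
   relation on points, whose classes carry the semiregular summands.
   An algebraic isomorphism is realised by choosing in each class a base point
   and an image of it in the matching fiber: thinness then forces the images of
   the other points, and between distinct classes there is nothing to check.
   Separability follows directly; applied to the identity, with base points
   sent anywhere in their fibers, the construction gives enough automorphisms
   for schurity. *)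

(** * Colours of pairs and intersection numbers *)

Definition rel_of (T : finType) (S : {set {set T * T}}) (x y : T) :=
  pblock S (x, y).

Definition fiber_of (T : finType) (S : {set {set T * T}}) (a : T) : {set T} :=
  [set x | rel_of S x x == rel_of S a a].

Section Coherent.

Variables (T : finType) (S : {set {set T * T}}).
Hypothesis cohS : coherent [set: T] S.

Local Notation R := (rel_of S).

Lemma rel_of_in x y : R x y \in S.
Proof.
by case: cohS => /and3P[/eqP covS _ _] _ _ _; rewrite pblock_mem // covS !inE.
Qed.

Lemma mem_rel s x y : s \in S -> ((x, y) \in s) = (R x y == s).
Proof.
case: cohS => /and3P[/eqP covS trS _] _ _ _ Ss.
apply/idP/eqP => [xy_s | <-]; first exact: def_pblock.
by rewrite mem_pblock covS !inE.
Qed.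

Lemma mem_rel_of x y : (x, y) \in R x y.
Proof. by rewrite mem_rel ?rel_of_in. Qed.

Lemma rel_ofP s : s \in S -> exists x y, s = R x y.
Proof.
move=> Ss; case: cohS => /and3P[_ _ S'0] _ _ _.
have [s0 | [[x y] xy_s]] := set_0Vmem s; first by rewrite -s0 Ss in S'0.
by exists x, y; apply/esym/eqP; rewrite -mem_rel.
Qed.

(** The diagonal is a union of basis relations, so a colour that meets it lies inside it. *)
Lemma rel_of_diag a x y : R x y = R a a -> x = y.
Proof.
case: cohS => _ [S0 sS0 covS0] _ _ eqR.
have: (a, a) \in cover S0 by rewrite covS0 !inE eqxx.
case/bigcupP=> s S0s; have Ss := subsetP sS0 s S0s.
rewrite mem_rel // -eqR -mem_rel // => xy_s.
have: (x, y) \in cover S0 by apply/bigcupP; exists s.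
by rewrite covS0 !inE /= => /andP[/eqP].
Qed.

Lemma conv_rel_of x y : conv_rel (R x y) = R y x.
Proof.
case: cohS => _ _ convS _; apply/esym/eqP.
by rewrite -mem_rel ?convS ?rel_of_in // inE mem_rel_of.
Qed.

Lemma rel_of_sym x y u v : R x y = R u v -> R y x = R v u.
Proof. by rewrite -!(conv_rel_of _ y, conv_rel_of _ v) => ->. Qed.

(** Turns intersection numbers into triangles: from here on only their positivity matters. *)
Lemma inter_num_gt0 r s a c : r \in S -> s \in S ->
  0 < inter_num r s (R a c) <-> exists b, R a b = r /\ R b c = s.
Proof.
move=> Sr Ss; rewrite /inter_num.
case: pickP => [p ac_p | /(_ (a, c))]; last by rewrite mem_rel_of.
have [_ _ _ inumS] := cohS; have ac := mem_rel_of a c.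
rewrite (inumS _ _ _ Sr Ss (rel_of_in a c) _ _ ac_p ac).
rewrite card_gt0; split=> [/set0Pn[b] | [b [ab bc]]].
  by rewrite !inE !mem_rel // => /andP[/eqP ab /eqP bc]; exists b.
by apply/set0Pn; exists b; rewrite !inE !mem_rel // ab bc !eqxx.
Qed.

Lemma thinP s : s \in S -> thin s <->
  (forall x y z, R x y = s -> R x z = s -> y = z) /\
  (forall x y z, R x z = s -> R y z = s -> x = y).
Proof.
move=> Ss; split=> [thin_s | [fun_s inj_s] x].
  split=> x y z xy xz.
    by have [/card_le1_eqP le1 _] := thin_s x; apply/esym/le1;
      rewrite ?inE ?mem_rel ?xy ?xz.
  by have [_ /card_le1_eqP le1] := thin_s z; apply/esym/le1;
    rewrite ?inE ?mem_rel ?xy ?xz.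
split; apply/card_le1_eqP => z y; rewrite !inE !mem_rel // => /eqP xz /eqP xy.
  exact: fun_s xy xz.
exact: inj_s xy xz.
Qed.

End Coherent.

(** * Moving triangles along an algebraic isomorphism *)

Lemma algebraic_iso_id (T : finType) (S : {set {set T * T}}) :
  algebraic_iso S S id.
Proof. by split=> //; apply: imset_id. Qed.

Section AlgebraicIso.

Variables (T T' : finType) (S : {set {set T * T}}) (S' : {set {set T' * T'}}).
Variable phi : {set T * T} -> {set T' * T'}.
Hypotheses (cohS : coherent [set: T] S) (cohS' : coherent [set: T'] S').
Hypothesis isoS : algebraic_iso S S' phi.

Local Notation R := (rel_of S).
Local Notation R' := (rel_of S').

Let phi_in s : s \in S -> phi s \in S'.
Proof. by case: isoS => _ <- _; apply: imset_f. Qed.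

Lemma iso_rel_inj a b c d : phi (R a b) = phi (R c d) -> R a b = R c d.
Proof. by case: isoS => inj _ _; apply: inj; apply: rel_of_in. Qed.

(** Positive intersection numbers stay positive under [phi], so a triangle on (a, c) is copied onto
    any pair of the matching colour. *)
Lemma iso_forth a c a' c' b : R' a' c' = phi (R a c) ->
  exists b', R' a' b' = phi (R a b) /\ R' b' c' = phi (R b c).
Proof.
move=> eqac; have RS := rel_of_in cohS.
apply/inter_num_gt0; rewrite ?phi_in ?RS // eqac.
case: isoS => _ _ <-; rewrite ?RS //.
by apply/inter_num_gt0; rewrite ?RS //; exists b.
Qed.

Lemma iso_back a c a' c' b' : R' a' c' = phi (R a c) ->
  exists b, R' a' b' = phi (R a b) /\ R' b' c' = phi (R b c).
Proof.
move=> eqac; have [_ phiS inum] := isoS; have RS := rel_of_in cohS.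
have [r Sr Er]: exists2 r, r \in S & R' a' b' = phi r.
  by apply/imsetP; rewrite phiS rel_of_in.
have [s Ss Es]: exists2 s, s \in S & R' b' c' = phi s.
  by apply/imsetP; rewrite phiS rel_of_in.
have /(inter_num_gt0 cohS a c Sr Ss)[b [ab bc]] : 0 < inter_num r s (R a c).
  rewrite inum ?RS // -eqac; apply/inter_num_gt0; rewrite ?phi_in //.
  by exists b'.
by exists b; rewrite ab bc.
Qed.

Lemma iso_diag a x' y' : R' x' y' = phi (R a a) -> x' = y'.
Proof.
(* The triangle x', y', y' pulls back to a, b, a. Injectivity of [phi] forces b = a, so (x', y') has
   the colour of (y', y'). *)
move=> eq; have [b [eq1 eq2]] := iso_back y' eq.
have Dab: a = b.
  by apply: (rel_of_diag cohS (a := a)); apply: iso_rel_inj; rewrite -eq1.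
by apply: (rel_of_diag cohS' (a := y')); rewrite eq eq2 -Dab.
Qed.

Lemma iso_left a b x' y' : R' x' y' = phi (R a b) -> R' x' x' = phi (R a a).
Proof. by case/(iso_forth a) => b' [eq1 _]; rewrite -eq1 -(iso_diag eq1). Qed.

Lemma iso_right a b x' y' : R' x' y' = phi (R a b) -> R' y' y' = phi (R b b).
Proof. by case/(iso_forth b) => b' [_ eq1]; rewrite -eq1 (iso_diag eq1). Qed.

Lemma iso_reflect_diag a b x' : R' x' x' = phi (R a b) -> a = b.
Proof.
move=> eq; apply: (rel_of_diag cohS (a := b)); apply: iso_rel_inj.
by rewrite -eq -(iso_right eq).
Qed.

(** Uniqueness of the successor at the single point a is enough: a second successor of x' pulls back
    to a successor of a. *)
Lemma iso_functional a b x' y' z' : (forall c, R a c = R a b -> c = b) ->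
  R' x' y' = phi (R a b) -> R' x' z' = phi (R a b) -> y' = z'.
Proof.
move=> fun_ab eqy eqz; have [c [eq1 eq2]] := iso_back z' eqy.
have Dc: c = b by apply/fun_ab/iso_rel_inj; rewrite -eq1.
by apply/esym/(@iso_diag b); rewrite eq2 Dc.
Qed.

Lemma iso_point x : exists x', R' x' x' = phi (R x x).
Proof.
have /(rel_ofP cohS')[u [v eq]] := phi_in (rel_of_in cohS x x).
by exists u; rewrite eq (iso_diag (esym eq)).
Qed.

Lemma iso_pointV x' : exists x, R' x' x' = phi (R x x).
Proof.
have: R' x' x' \in phi @: S by case: isoS => _ -> _; apply: rel_of_in.
case/imsetP=> s /(rel_ofP cohS)[u [v ->]] eq.
by exists u; rewrite eq (iso_reflect_diag eq).
Qed.

Lemma iso_rel_image f : bijective f ->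
    (forall x y, R' (f x) (f y) = phi (R x y)) ->
  forall s, s \in S -> rel_image f s = phi s.
Proof.
case=> g fK gK f_iso s Ss; apply/setP=> [[u v]].
rewrite [in RHS](mem_rel cohS') ?phi_in //.
apply/imsetP/eqP=> [[[x y] /=] | eq].
  by rewrite (mem_rel cohS) // => /eqP <- [-> ->]; rewrite f_iso.
exists (g u, g v); rewrite /= ?gK // (mem_rel cohS) //; apply/eqP.
by case: isoS => inj _ _; apply: inj; rewrite ?rel_of_in // -f_iso !gK.
Qed.

End AlgebraicIso.

(** * Thin colours and fibers, with the previous lemmas applied to the identity *)

Section Transfer.

Variables (T : finType) (S : {set {set T * T}}).
Hypothesis cohS : coherent [set: T] S.

Local Notation R := (rel_of S).

Lemma rel_of_forth a c a' c' b : R a' c' = R a c ->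
  exists b', R a' b' = R a b /\ R b' c' = R b c.
Proof. exact: (iso_forth cohS cohS (algebraic_iso_id S)). Qed.

Lemma rel_of_left a b x y : R x y = R a b -> R x x = R a a.
Proof. exact: (iso_left cohS cohS (algebraic_iso_id S)). Qed.

Lemma rel_of_right a b x y : R x y = R a b -> R y y = R b b.
Proof. exact: (iso_right cohS cohS (algebraic_iso_id S)). Qed.

Lemma thin_rel_of a b : (forall c, R a c = R a b -> c = b) ->
  (forall c, R c b = R a b -> c = a) -> thin (R a b).
Proof.
move=> fun_ab inj_ab; apply/(thinP cohS); first exact: rel_of_in.
have isoS := algebraic_iso_id S; split=> x y z xy xz.
  exact: (iso_functional cohS cohS isoS fun_ab xy xz).
have fun_ba c: R b c = R b a -> c = a by move/(rel_of_sym cohS)/inj_ab.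
have [zx zy] := (rel_of_sym cohS xy, rel_of_sym cohS xz).
exact: (iso_functional cohS cohS isoS fun_ba zx zy).
Qed.

Lemma thin_functional a b x y z :
  thin (R a b) -> R x y = R a b -> R x z = R a b -> y = z.
Proof.
by move/(thinP cohS (rel_of_in cohS a b)) => [fun_ab _]; apply: fun_ab.
Qed.

Lemma thin_sym a b : thin (R a b) -> thin (R b a).
Proof.
move/(thinP cohS (rel_of_in cohS a b)) => [fun_ab inj_ab].
apply: thin_rel_of => c /(rel_of_sym cohS) eq; first exact: inj_ab eq _.
exact: fun_ab eq _.
Qed.

Lemma thin_trans a b c : thin (R a b) -> thin (R b c) -> thin (R a c).
Proof.
(* Copying v onto (u, x) returns v itself by thinness of (u, v); then x and w have the same colour
   from v. *)
have half u v w x : thin (R u v) -> thin (R v w) -> R u x = R u w -> x = w.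
  move=> uv vw /(@rel_of_forth _ _ _ _ v) [y [eq1 eq2]].
  rewrite (thin_functional uv eq1 (erefl _)) in eq2.
  exact: thin_functional vw eq2 _.
move=> ab bc; apply: thin_rel_of => x; first exact: half ab bc.
move/(rel_of_sym cohS); exact: half (thin_sym bc) (thin_sym ab).
Qed.

Lemma fiber_ofP D : D \in fibers S -> exists a, D = fiber_of S a.
Proof.
rewrite inE => SD; have [a [b Dab]] := rel_ofP cohS SD; exists a.
have diagE x: (x \in D) = (R x x == diag_rel D).
  by rewrite -(mem_rel cohS) // inE eqxx.
have: (a, b) \in diag_rel D by rewrite Dab mem_rel_of.
rewrite inE /= => /andP[/eqP eq_ab _].
by apply/setP=> x; rewrite diagE Dab -eq_ab inE.
Qed.

Lemma diag_fiber_of a : diag_rel (fiber_of S a) = R a a.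
Proof.
apply/setP=> [[x y]]; rewrite (mem_rel cohS _ _ (rel_of_in cohS a a)) !inE /=.
apply/andP/eqP=> [[/eqP <- /eqP] // | eq].
by rewrite (rel_of_left eq) (rel_of_diag cohS eq) !eqxx.
Qed.

Lemma fibers_fiber_of a : fiber_of S a \in fibers S.
Proof. by rewrite inE diag_fiber_of rel_of_in. Qed.

Lemma rel_of_within D x y : D \in fibers S -> x \in D -> y \in D ->
  R x y \in basis_within D S.
Proof.
move=> /fiber_ofP[a ->]; rewrite !inE rel_of_in //= => /eqP xa /eqP ya.
apply/subsetP=> [[u v]]; rewrite (mem_rel cohS) ?rel_of_in // => /eqP eq.
by rewrite !inE /= (rel_of_left eq) (rel_of_right eq) xa ya !eqxx.
Qed.

End Transfer.

(** * Points with the same colours towards a fiber *)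

Section Quasiregular.

Variables (GG : group_family) (T : finType) (S : {set {set T * T}}).
Hypothesis GG_simple : forall (gT : finGroupType) (G : {group gT}),
  GG G -> simple G.
Hypotheses (cohS : coherent [set: T] S) (quasiS : quasiregular_cc S).
Hypothesis typeS : of_type GG S.

Local Notation R := (rel_of S).

Lemma thin_fiber x y : R x x = R y y -> thin (R x y).
Proof.
move=> xy; apply: (quasiS (fibers_fiber_of cohS x)).
by rewrite rel_of_within ?fibers_fiber_of // inE ?xy.
Qed.

Lemma fiber_functional x y u v w :
  R x x = R y y -> R u v = R x y -> R u w = R x y -> v = w.
Proof. by move=> xy; apply/(thin_functional cohS)/thin_fiber. Qed.

Definition indist b x y := [forall z, (R z z == R b b) ==> (R x z == R y z)].

Lemma indistP b x y :
  reflect (forall z, R z z = R b b -> R x z = R y z) (indist b x y).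
Proof.
apply: (iffP forallP) => [ind z /eqP zb | ind z].
  by have:= ind z; rewrite zb => /eqP.
by apply/implyP=> /eqP/ind/eqP.
Qed.

(** For z in the fiber of b, copy z from (x, c) to (y, c). The copy has the colour of z towards c,
    and colours inside a fiber are thin, so it is z. *)
Lemma indist_single b c x y : R c c = R b b -> R x c = R y c -> indist b x y.
Proof.
move=> cb eqc; apply/indistP=> z zb.
have [w [yw wc]] := rel_of_forth cohS z (esym eqc).
suffices Dw: w = z by rewrite -yw Dw.
by apply: (fiber_functional _ (rel_of_sym cohS wc)); rewrite ?cb ?zb.
Qed.

(** Makes indistinguishability a property of the colour of (x, y), hence of a group element. *)
Lemma indist_rel b x y u v : R x y = R u v -> indist b x y -> indist b u v.
Proof.
move=> eq /indistP/(_ b (erefl _)) ind.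
have [c [uc cv]] := rel_of_forth cohS b (esym eq).
apply: (@indist_single b c); first exact: rel_of_right uc.
by rewrite uc ind; apply: rel_of_sym.
Qed.

(** Moving both points along one colour of their fiber preserves indistinguishability; this is what
    gives normality. The copy of u onto (y, b) must be v by thinness. *)
Lemma indist_shift b x y u v :
  R y v = R x u -> R x x = R u u -> indist b x y -> indist b u v.
Proof.
move=> eq xu /indistP/(_ b (erefl _)) ind.
have [w [yw wb]] := rel_of_forth cohS u (esym ind).
apply: (@indist_single b b) => //.
by rewrite -wb (fiber_functional xu yw eq).
Qed.

(** * The group of colours on one fiber and its normal subgroup *)

Section FiberGroup.

Variables (gT : finGroupType) (G : {group gT}) (phi : gT -> {set T * T}).
Variables (a b : T).
Hypotheses (inj_phi : {in G &, injective phi}).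
Hypothesis im_phi : phi @: G = basis_within (fiber_of S a) S.
Hypothesis phiM : {in G &, forall x y, phi (x * y) = comp_rel (phi x) (phi y)}.

Lemma fiber_group_rel g : g \in G -> exists x y,
  [/\ phi g = R x y, R x x = R a a & R y y = R a a].
Proof.
move=> Gg; have: phi g \in phi @: G by apply: imset_f.
rewrite im_phi inE => /andP[/(rel_ofP cohS)[x [y ->]] /subsetP/(_ (x, y))].
by rewrite mem_rel_of // !inE => /(_ isT)/andP[/eqP ? /eqP ?]; exists x, y.
Qed.

Lemma fiber_group_out g x : g \in G -> R x x = R a a ->
  exists2 y, phi g = R x y & R y y = R a a.
Proof.
move=> /fiber_group_rel[u [v [-> ua va]]] xa.
have [|y [eq _]] := @rel_of_forth _ _ cohS u u x x v; first by rewrite ua.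
by exists y; rewrite ?eq // (rel_of_right cohS eq).
Qed.

Lemma fiber_group_ex x y : R x x = R a a -> R y y = R a a ->
  exists2 g, g \in G & phi g = R x y.
Proof.
move=> xa ya; have: R x y \in phi @: G.
  by rewrite im_phi rel_of_within ?fibers_fiber_of // inE ?xa ?ya.
by case/imsetP=> g Gg ->; exists g.
Qed.

Lemma fiber_groupM g h x y z : g \in G -> h \in G ->
  phi g = R x y -> phi h = R y z -> phi (g * h) = R x z.
Proof.
move=> Gg Gh gxy hyz; have := fiber_group_rel (groupM Gg Gh).
case=> u [v [gh _ _]]; rewrite gh; apply/esym/eqP.
rewrite -(mem_rel cohS) ?rel_of_in // -gh phiM // inE.
by apply/existsP; exists y; rewrite gxy hyz !mem_rel_of.
Qed.

Lemma fiber_group1 x : R x x = R a a -> phi 1 = R x x.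
Proof.
move=> xa; have [g Gg gx] := fiber_group_ex xa xa.
(* The diagonal colour is idempotent, and the only idempotent of a group is 1. *)
suffices /eqP: g * g = g * 1 by rewrite (inj_eq (mulgI g)) => /eqP <-.
rewrite mulg1; apply: inj_phi; rewrite ?groupM //.
by rewrite gx; apply: (fiber_groupM Gg Gg gx gx).
Qed.

(** One witnessing pair is asked for; by [indist_rel] every other pair of that colour would do as
    well. *)
Definition indist_group :=
  [set g in G | [exists x, [exists y,
     [&& phi g == R x y, R x x == R a a & indist b x y]]]].

Lemma indist_groupP g x y : g \in G -> phi g = R x y -> R x x = R a a ->
  (g \in indist_group) = indist b x y.
Proof.
move=> Gg gxy xa; rewrite inE Gg /=; apply/existsP/idP=> [[u]|ind].
  by case/existsP=> v /and3P[/eqP guv _]; apply: indist_rel; rewrite -guv.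
by exists x; apply/existsP; exists y; rewrite gxy xa ind !eqxx.
Qed.

Lemma indist_group_set : group_set indist_group.
Proof.
have [u [v [_ ua _]]] := fiber_group_rel (group1 G).
apply/group_setP; split.
  by rewrite (indist_groupP (group1 G) (fiber_group1 ua) ua); apply/indistP.
move=> g h Ng Nh; have [Gg Gh]: g \in G /\ h \in G.
  by move: Ng Nh; rewrite !inE => /andP[-> _] /andP[-> _].
have [x gux xa] := fiber_group_out Gg ua.
have [y hxy ya] := fiber_group_out Gh xa.
move: Ng; rewrite (indist_groupP Gg gux ua) => /indistP indg.
move: Nh; rewrite (indist_groupP Gh hxy xa) => /indistP indh.
rewrite (indist_groupP (groupM Gg Gh) (fiber_groupM Gg Gh gux hxy) ua).
by apply/indistP=> z zb; rewrite indg ?indh.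
Qed.

Canonical indist_Group := Group indist_group_set.

Lemma indist_group_normal : indist_group <| G.
Proof.
apply/andP; split; first by apply/subsetP=> g; rewrite inE => /andP[].
apply/subsetP=> h Gh; rewrite inE; apply/subsetP=> _ /imsetP[g Ng ->].
have Gg : g \in G by move: Ng; rewrite inE => /andP[].
have [u [_ [_ ua _]]] := fiber_group_rel (group1 G).
(* Follow h^-1, g, h along u, x, y, z, so that (u, z) has the colour of g ^ h. Since h leads from x
   back to u, the pairs (x, u) and (y, z) share the colour of h, and [indist_shift] carries x, y to
   u, z. *)
have [x hux xa] := fiber_group_out (groupVr Gh) ua.
have [y gxy ya] := fiber_group_out Gg xa.
have [z hyz za] := fiber_group_out Gh ya.
have [w hxw wa] := fiber_group_out Gh xa.
have Dw: u = w.
  apply: (@rel_of_diag _ _ cohS u).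
  rewrite -(fiber_groupM (groupVr Gh) Gh hux hxw) mulVg.
  exact: fiber_group1.
have gh: phi (g ^ h) = R u z.
  rewrite conjgE mulgA; apply: (fiber_groupM _ Gh _ hyz);
    rewrite ?groupMr ?groupV //.
  by apply: (fiber_groupM _ Gg hux gxy); rewrite groupV.
rewrite (indist_groupP (groupJ Gg Gh) gh ua).
apply: (@indist_shift b x y); rewrite ?ua ?xa //; first by rewrite -hyz hxw Dw.
by rewrite -(indist_groupP Gg gxy xa).
Qed.

Lemma indist_dichotomy : simple G ->
  (forall x y, R x x = R a a -> R y y = R a a -> indist b x y) \/
  (forall x y, R x x = R a a -> R y y = R a a -> indist b x y -> x = y).
Proof.
case/simpleP=> _ /(_ indist_Group indist_group_normal)[] /= DN; [right|left];
  move=> x y xa ya; have [g Gg gxy] := fiber_group_ex xa ya;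
  rewrite -(indist_groupP Gg gxy xa) DN //.
rewrite inE => /eqP g1; apply: (@rel_of_diag _ _ cohS x).
by rewrite -gxy g1; apply: fiber_group1.
Qed.

Lemma fiber_nontrivial : simple G -> exists2 c, c != a & R c c = R a a.
Proof.
case/simpleP=> ntG _; have [g Gg nt_g] := trivgPn _ ntG.
have [c gac ca] := fiber_group_out Gg (erefl _); exists c => //.
apply: contraNneq nt_g => Dc; apply/eqP/inj_phi; rewrite // gac Dc.
exact/esym/fiber_group1.
Qed.

End FiberGroup.

(** * Dichotomy between two fibers: thin or full *)

Lemma quasi_nontrivial a : exists2 c, c != a & R c c = R a a.
Proof.
have [gT [G [phi [/GG_simple simG inj im phiM]]]] :=
  typeS (fibers_fiber_of cohS a).
exact: (fiber_nontrivial inj im phiM simG).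
Qed.

Lemma quasi_dichotomy_left a b :
  (forall x y z, R x x = R a a -> R y y = R a a -> R z z = R b b ->
     R x z = R y z) \/
  (forall x y z, R x x = R a a -> R y y = R a a -> R z z = R b b ->
     R x z = R y z -> x = y).
Proof.
have [gT [G [phi [/GG_simple simG inj im phiM]]]] :=
  typeS (fibers_fiber_of cohS a).
have [ind|ind] := indist_dichotomy b inj im phiM simG; [left|right].
  by move=> x y z xa ya zb; apply/indistP: zb; apply: ind.
by move=> x y z xa ya zb eq; apply: ind => //; apply: indist_single eq.
Qed.

Lemma quasi_dichotomy a b : thin (R a b) \/
  (forall x y, R x x = R a a -> R y y = R b b -> R x y = R a b).
Proof.
have sym := rel_of_sym cohS.
(* Excludes the mixed case. Take w other than v in the fiber of v, and x with (w, x) coloured as (v,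
   u). Fullness on the side of u gives (w, u) the colour of (w, x), hence of (v, u), so injectivity
   on the side of v forces w = v. *)
have clash u v :
    (forall x y z, R x x = R u u -> R y y = R u u -> R z z = R v v ->
       R x z = R y z) ->
    ~ (forall x y z, R x x = R v v -> R y y = R v v -> R z z = R u u ->
       R x z = R y z -> x = y).
  move=> eqR injR; have [w nt_w wv] := quasi_nontrivial v.
  have [x [wx xw]] := rel_of_forth cohS u wv.
  case/eqP: nt_w; apply: (injR w v u) => //; rewrite -wx.
  by apply/sym/eqR; rewrite ?(rel_of_right cohS wx).
case: (quasi_dichotomy_left a b) => [eql | injl];
  case: (quasi_dichotomy_left b a) => [eqr | injr].
- right=> x y xa yb; rewrite (eql x a y) //; apply: sym; exact: eqr.
- by case: (clash a b).
- by case: (clash b a).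
left; apply: (thin_rel_of cohS) => c eq.
  apply: (injr c b a) => //; first exact: rel_of_right eq.
  exact: sym.
by apply: (injl c a b) => //; apply: rel_of_left eq.
Qed.

(** * Classes of points joined by thin colours *)

Definition thinb s := [forall x : T,
  (#|neighbors x s| <= 1) && (#|neighbors x (conv_rel s)| <= 1)].

Lemma thinbP s : reflect (thin s) (thinb s).
Proof. by apply: (iffP forallP) => thin_s x; apply/andP; apply: thin_s. Qed.

Definition thin_root x := odflt x [pick y | thinb (R x y)].

Lemma thin_root_thin x : thin (R (thin_root x) x).
Proof.
rewrite /thin_root; case: pickP => [y /thinbP | _]; first exact: thin_sym.
exact: thin_fiber.
Qed.

(** Points of one class have extensionally equal candidate predicates, so [pick] returns the same
    point; the default is never reached because x is itself a candidate. *)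
Lemma thin_root_eq x y : thin (R x y) -> thin_root x = thin_root y.
Proof.
move=> xy; rewrite /thin_root.
have eq_xy : (fun z => thinb (R x z)) =1 (fun z => thinb (R y z)).
  by move=> z; apply/thinbP/thinbP; apply: (thin_trans cohS);
    rewrite //; apply: thin_sym.
rewrite -(eq_pick eq_xy); case: pickP => // /(_ x)/thinbP[].
exact: thin_fiber.
Qed.

Lemma thin_rootP x y : thin_root x = thin_root y -> thin (R x y).
Proof.
move=> eq; apply: (thin_trans cohS _ (thin_root_thin y)); rewrite -eq.
exact/thin_sym/thin_root_thin.
Qed.

(** * Realising algebraic isomorphisms; separability *)

(** The choice of base points is a parameter, because schurity needs prescribed ones. The map sends
    x to the point placed with respect to [h (base x)] as x is with respect to [base x]. *)
Lemma iso_extends (T' : finType) (S' : {set {set T' * T'}})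
    (phi : {set T * T} -> {set T' * T'}) (base : T -> T) (h : T -> T') :
    coherent [set: T'] S' -> algebraic_iso S S' phi ->
    (forall x, thin (R (base x) x)) ->
    (forall x y, thin (R x y) -> base x = base y) ->
    (forall x, rel_of S' (h x) (h x) = phi (R x x)) ->
  exists f : T -> T', [/\ bijective f,
    forall x, rel_of S' (h (base x)) (f x) = phi (R (base x) x)
    & forall x y, rel_of S' (f x) (f y) = phi (R x y)].
Proof.
move=> cohS' isoS thin_base base_eq hP.
have fun_iso a b x y z : thin (R a b) -> rel_of S' x y = phi (R a b) ->
    rel_of S' x z = phi (R a b) -> y = z.
  move=> ab; apply: (iso_functional cohS cohS' isoS) => c eq.
  exact: thin_functional ab eq _.
have /fin_all_exists[f fP] x : exists y,
    rel_of S' (h (base x)) y = phi (R (base x) x).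
  by have [y [eq _]] := iso_forth cohS cohS' isoS x (hP (base x)); exists y.
have f_point x : rel_of S' (f x) (f x) = phi (R x x).
  exact: iso_right (fP x).
have f_iso x y : rel_of S' (f x) (f y) = phi (R x y).
  have [xy | full] := quasi_dichotomy x y.
    (* Same class, hence same base point: the copy of x in the triangle of base, x, y must be
       [f x]. *)
    have [w [eq1 <-]] := iso_forth cohS cohS' isoS x (fP y).
    rewrite -(base_eq x y xy) in eq1.
    by rewrite (fun_iso _ _ _ _ _ (thin_base x) eq1 (fP x)).
  (* Otherwise all pairs between the two fibers have one colour, so matching the fibers of the end
     points suffices. *)
  have: rel_of S' (f x) (f y) \in phi @: S.
    by case: isoS => _ -> _; apply: rel_of_in.
  case/imsetP=> t /(rel_ofP cohS)[u [v ->]] eq; rewrite eq.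
  congr phi; apply: full; apply: (iso_rel_inj cohS isoS).
    by rewrite -(iso_left cohS cohS' isoS eq).
  by rewrite -(iso_right cohS cohS' isoS eq).
exists f; split=> //.
(* Surjectivity: pull y' back along the image of a point y of the matching fiber. The point z found
   lies in the fiber of y, so thinness of (y, z) gives [f z = y']. *)
have /fin_all_exists[g gK] y' : exists x, f x = y'.
  have [y eqy] := iso_pointV cohS cohS' isoS y'.
  have [|z [eqz _]] := @iso_back _ _ _ _ _ cohS cohS' isoS y y (f y) (f y) y'.
    exact: f_point.
  have yz: thin (R y z).
    apply/thin_fiber/(iso_rel_inj cohS isoS).
    by rewrite -eqy (iso_right cohS cohS' isoS eqz).
  by exists z; apply: fun_iso yz _ eqz.
exists g => // x; apply: (iso_reflect_diag cohS cohS' isoS (x' := f x)).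
by rewrite -f_iso gK.
Qed.

Lemma quasi_separable : separable_cc S.
Proof.
move=> T' S' phi cohS' isoS.
have /fin_all_exists[h hP] := iso_point cohS cohS' isoS.
have [f [f_bij _ f_iso]] :=
  iso_extends cohS' isoS thin_root_thin thin_root_eq hP.
exists f => //; exact: iso_rel_image f_iso.
Qed.

(** * Automorphisms and schurity *)

Lemma quasi_homogeneous a b a' b' : R a' b' = R a b ->
  exists f : T -> T,
    [/\ bijective f, f a = a', f b = b' & forall x y, R (f x) (f y) = R x y].
Proof.
move=> eqR.
(* The class of a gets base point a, and that of b, if different, gets b; [h] then prescribes their
   images. When both lie in one class, the image of b is forced by thinness of (a, b). *)
pose base x := if thinb (R a x) then a else
               if thinb (R b x) then b else thin_root x.
have thin_base x : thin (R (base x) x).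
  rewrite /base; do 2!case: ifP => [/thinbP // | _]; exact: thin_root_thin.
have base_eq x y : thin (R x y) -> base x = base y.
  move=> xy; have eq_thin z: thinb (R z x) = thinb (R z y).
    by apply/thinbP/thinbP => zx; apply: (thin_trans cohS zx);
      rewrite //; apply: thin_sym.
  by rewrite /base !eq_thin (thin_root_eq xy).
pose h x := if x == a then a' else if x == b then b' else x.
have hP x : R (h x) (h x) = R x x.
  rewrite /h; case: eqP => [->|_]; first exact: rel_of_left eqR.
  by case: eqP => [->|_] //; apply: rel_of_right eqR.
have [f [f_bij fP f_iso]] :=
  iso_extends cohS (algebraic_iso_id S) thin_base base_eq hP.
have fa: f a = a'.
  have := fP a; have -> : base a = a.
    by rewrite /base (introT (thinbP _)) //; apply: thin_fiber.
  by rewrite /h eqxx => /(rel_of_diag cohS).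
exists f; split=> //.
have [ab | /thinbP n_ab] := thinbP (R a b).
  by apply: (thin_functional cohS ab (x := a')); rewrite // -fa f_iso.
have := fP b; have -> : base b = b.
  rewrite /base (negPf n_ab) (introT (thinbP _)) //; exact: thin_fiber.
rewrite /h eqxx; case: eqP => [Db | _ /(rel_of_diag cohS) //].
by case/thinbP: n_ab; rewrite Db; apply: thin_fiber.
Qed.

Definition rel_automs := [set g : {perm T} |
  [forall x, [forall y, R (g x) (g y) == R x y]]].

Lemma rel_automsP (g : {perm T}) :
  reflect (forall x y, R (g x) (g y) = R x y) (g \in rel_automs).
Proof. by rewrite inE; apply: (iffP 'forall_'forall_eqP). Qed.

Lemma rel_automs_group_set : group_set rel_automs.
Proof.
apply/group_setP; split; first by apply/rel_automsP=> x y; rewrite !perm1.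
move=> g h /rel_automsP gP /rel_automsP hP; apply/rel_automsP=> x y.
by rewrite !permM hP gP.
Qed.

Lemma quasi_schurian : schurian S.
Proof.
exists (group rel_automs_group_set) => /=.
have orbE x y : pair_orbit rel_automs (x, y) = R x y.
  apply/setP=> [[u v]]; rewrite [RHS](mem_rel cohS) ?rel_of_in //.
  apply/imsetP/eqP=> [[g /rel_automsP gP /= [-> ->]] | eqR]; first exact: gP.
  have [f [/bij_inj f_inj fx fy f_iso]] := quasi_homogeneous eqR.
  exists (perm f_inj); last by rewrite /= !permE fx fy.
  by apply/rel_automsP=> z w; rewrite !permE.
apply/setP=> s; apply/idP/imsetP=> [/(rel_ofP cohS)[x [y ->]] | [[x y] _ ->]].
  by exists (x, y); rewrite ?orbE.
by rewrite orbE rel_of_in.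
Qed.

(** * Decomposition into semiregular summands *)

Definition thin_class i := [set x | thin_root x == i].

(** Colours inside a fiber are thin, so a class is a union of fibers and contains both ends of every
    pair coloured like (x, y). *)
Lemma rel_of_thin_class i x y : x \in thin_class i -> y \in thin_class i ->
  R x y \in basis_within (thin_class i) S.
Proof.
rewrite !inE rel_of_in // => /eqP xi /eqP yi; apply/subsetP=> [[u v]].
rewrite (mem_rel cohS) ?rel_of_in // !inE /= => /eqP eqR.
rewrite -{1}xi -yi (@thin_root_eq u x) ?(@thin_root_eq v y) ?eqxx //.
  exact/thin_fiber/(rel_of_right cohS eqR).
exact/thin_fiber/(rel_of_left cohS eqR).
Qed.

Lemma basis_thin_classP i s : s \in basis_within (thin_class i) S ->
  exists x y, [/\ s = R x y, x \in thin_class i & y \in thin_class i].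
Proof.
rewrite inE => /andP[/(rel_ofP cohS)[x [y ->]] /subsetP/(_ (x, y))].
by rewrite mem_rel_of // in_setX => /(_ isT)/andP[xi yi]; exists x, y.
Qed.

Lemma thin_class_coherent i :
  coherent (thin_class i) (basis_within (thin_class i) S).
Proof.
have [/and3P[/eqP covS trS S'0] _ convS inumS] := cohS.
have sub: basis_within (thin_class i) S \subset S.
  by apply/subsetP=> s; rewrite inE => /andP[].
split.
- apply/and3P; split; last by apply: contra S'0; apply: (subsetP sub).
    rewrite eqEsubset; apply/andP; split; apply/subsetP=> [[x y]].
      by case/bigcupP=> s; rewrite inE => /andP[_ /subsetP]; apply.
    rewrite in_setX => /andP[xi yi]; apply/bigcupP; exists (R x y).
      exact: rel_of_thin_class.
    exact: mem_rel_of.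
  exact: trivIsetS sub trS.
- exists [set R x x | x in thin_class i].
    by apply/subsetP=> _ /imsetP[x xi ->]; apply: rel_of_thin_class.
  apply/setP=> [[x y]]; rewrite [RHS]inE /=; apply/bigcupP/andP.
    case=> _ /imsetP[z zi ->].
    rewrite (mem_rel cohS) ?rel_of_in // => /eqP eqR.
    rewrite (rel_of_diag cohS eqR) eqxx; split=> //.
    have := rel_of_thin_class zi zi.
    rewrite inE => /andP[_ /subsetP/(_ (x, y))].
    by rewrite (mem_rel cohS) ?rel_of_in // in_setX eqR eqxx => /(_ isT)/andP[].
  case=> /eqP <- xi; exists (R x x); first exact: imset_f.
  exact: mem_rel_of.
- move=> s /basis_thin_classP[x [y [-> xi yi]]].
  by rewrite conv_rel_of // rel_of_thin_class.
move=> r s t /(subsetP sub) Sr /(subsetP sub) Ss /(subsetP sub).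
exact: inumS.
Qed.

Lemma fibers_thin_class i D : D \in fibers (basis_within (thin_class i) S) <->
  exists2 x, x \in thin_class i & D = fiber_of S x.
Proof.
split=> [| [x xi ->]]; last first.
  by rewrite inE diag_fiber_of // rel_of_thin_class.
rewrite inE => SiD; have: D \in fibers S.
  by move: SiD; rewrite !inE => /andP[].
case/(fiber_ofP cohS)=> x DD; exists x => //.
move: SiD; rewrite DD diag_fiber_of // inE => /andP[_ /subsetP/(_ (x, x))].
by rewrite mem_rel_of // in_setX => /(_ isT)/andP[].
Qed.

Lemma rel_of_setX x y : thin_root x != thin_root y ->
  R x y = setX (fiber_of S x) (fiber_of S y).
Proof.
move=> n_xy; have [/thin_root_eq eq | full] := quasi_dichotomy x y.
  by rewrite eq eqxx in n_xy.
apply/setP=> [[u v]]; rewrite (mem_rel cohS) ?rel_of_in // !inE /=.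
apply/eqP/andP=> [eqR | [/eqP ux /eqP vy]]; last exact: full.
by rewrite (rel_of_left cohS eqR) (rel_of_right cohS eqR).
Qed.

Lemma quasi_direct_sum :
  direct_sum thin_class (fun i => basis_within (thin_class i) S) S.
Proof.
split.
- move=> i j n_ij; apply/pred0P=> x /=; rewrite !inE.
  by apply: contraNF n_ij => /andP[/eqP <- /eqP <-].
- apply/setP=> x; rewrite [RHS]inE; apply/bigcupP.
  by exists (thin_root x); rewrite ?inE.
move=> s; split=> [/(rel_ofP cohS)[x [y ->]] | [[i] | ]].
- have [eq | n_xy] := eqVneq (thin_root x) (thin_root y); [left | right].
    by exists (thin_root x); rewrite rel_of_thin_class // inE ?eq.
  exists (thin_root x), (thin_root y), (fiber_of S x), (fiber_of S y).
  split; rewrite ?rel_of_setX //; apply/fibers_thin_class.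
    by exists x; rewrite ?inE.
  by exists y; rewrite ?inE.
- by rewrite inE => /andP[].
case=> i [j [D [E [n_ij]]]].
case/fibers_thin_class=> x; rewrite inE => /eqP xi ->.
case/fibers_thin_class=> y; rewrite inE => /eqP yj -> ->.
by rewrite -rel_of_setX ?rel_of_in // xi yj.
Qed.

End Quasiregular.

Theorem theorem4p8 (GG : group_family)
  (GG_simple : forall (gT : finGroupType) (G : {group gT}),
     GG gT G -> simple G)
  (T : finType) (S : {set {set T * T}})
  (cohS : coherent [set: T] S) (quasiS : quasiregular_cc S)
  (typeS : of_type GG S) :
  (exists (I : finType) (Omega : I -> {set T}) (SS : I -> {set {set T * T}}),
     (forall i, coherent (Omega i) (SS i) /\ semiregular_cc (SS i))
     /\ direct_sum Omega SS S)
  /\ schurian S /\ separable_cc S.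
Proof.
split; last split; [| exact: quasi_schurian GG_simple cohS quasiS typeS
                  | exact: quasi_separable GG_simple cohS quasiS typeS].
(* The index set is all of T; an index that is not a root has an empty class. *)
exists T, (thin_class S), (fun i => basis_within (thin_class S i) S).
split=> [i|]; last exact: quasi_direct_sum GG_simple cohS quasiS typeS.
split=> [|s]; first exact: thin_class_coherent cohS quasiS i.
case/(basis_thin_classP cohS)=> x [y [-> ]]; rewrite !inE => /eqP xi /eqP yi.
by apply: (thin_rootP cohS quasiS); rewrite xi.
Qed.
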